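(* Let $p$ and $q$ be distinct primes and let $D = A \rtimes B$ be a semidirect product of its subgroups $A$ and $B$ (with $A$ normal in $D$) such that $A$ is a cyclic $p$-group, $B$ is a cyclic group of order $q$, and $[A,B] \neq 1$. Let $\mathfrak{L}$ be a locally finite variety of groups generated by a set $\mathfrak{X}$ of groups. If $D$ lies in $\mathfrak{L}$, then $D$ is a section of a group from $\mathfrak{X}$. In particular, if $\mathfrak{X}$ consists of a finite number of finite groups and $D$ belongs to the variety generated by $\mathfrak{X}$, then $D$ is a section of a group from $\mathfrak{X}$.
   Context: A section of a group $G$ is a homomorphic image of a subgroup of $G$; ''$D$ is a section of $G$'' means that $D$ is isomorphic to $S/N$ for some subgroup $S \le G$ and some normal subgroup $N$ of $S$. A variety of groups is a class of groups defined by a set of identities (laws); the variety generated by a set $\mathfrak{X}$ of groups is the smallest variety containing $\mathfrak{X}$, i.e. the class of all groups satisfying every law that holds in all groups of $\mathfrak{X}$. A variety of groups is locally finite if every finitely generated group in it is finite. A $p$-group here (for the cyclic group $A$) is a finite group of order a power of $p$. $[A,B]$ is the subgroup generated by all commutators $[a,b]$ with $a\in A$, $b\in B$. *)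

(* Defs.v *)
From HB Require Import structures.
From mathcomp Require Import all_boot all_fingroup all_solvable.
From mathcomp Require Import boolp classical_sets functions cardinality.

Set Implicit Arguments.
Unset Strict Implicit.
Unset Printing Implicit Defensive.

Local Open Scope classical_set_scope.
Local Open Scope group_scope.

(* Possibly infinite groups are terms of [groupType].  Classes of groups are
   plain predicates on [groupType]: [set groupType] is a universe
   inconsistency, since [set T] is itself a choiceType. *)
Definition group_class := groupType -> Prop.

(** Subgroups, generation, finiteness *)

Definition is_subgroup (G : groupType) (S : set G) : Prop :=
  group_closed (mem S).

Definition is_normal_in (G : groupType) (N S : set G) : Prop :=
  [/\ is_subgroup N, N `<=` S &
      forall x n : G, S x -> N n -> N (n ^ x)].

Definition generated_subgroup (G : groupType) (X : set G) : set G :=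
  smallest (@is_subgroup G) X.

Definition finitely_generated (G : groupType) : Prop :=
  exists X : set G, finite_set X /\ generated_subgroup X = [set: G].

Definition finite_group (G : groupType) : Prop := finite_set [set: G].

(** Sections *)

Definition set_mul (G : groupType) (X Y : set G) : set G :=
  [set x * y | x in X & y in Y].

(* The carrier of S / N; its group law is [set_mul]. *)
Definition quotient_cosets (G : groupType) (S N : set G) : set (set G) :=
  [set set_mul [set x] N | x in S].

Definition isomorphic_to_quotient (D G : groupType) (S N : set G) : Prop :=
  exists phi : D -> set G,
    set_bij [set: D] (quotient_cosets S N) phi /\
    forall x y : D, phi (x * y) = set_mul (phi x) (phi y).

Definition is_section (D G : groupType) : Prop :=
  exists S N : set G,
    [/\ is_subgroup S, is_normal_in N S & isomorphic_to_quotient D S N].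

(** Laws and varieties *)

(* An element of the free group on x_0, x_1, ...: the letter (n, false) is x_n
   and (n, true) is its inverse.  Words need not be reduced. *)
Definition word := seq (nat * bool).

Definition eval_word (G : groupType) (v : nat -> G) (w : word) : G :=
  \prod_(l <- w) (if l.2 then (v l.1)^-1 else v l.1).

Definition satisfies_law (G : groupType) (w : word) : Prop :=
  forall v : nat -> G, eval_word v w = 1.

Definition variety_of_laws (W : set word) : group_class :=
  fun G => forall w, W w -> satisfies_law G w.

Definition is_variety (V : group_class) : Prop :=
  exists W : set word, forall G, V G <-> variety_of_laws W G.

(* The smallest variety containing X. *)
Definition generated_variety (X : group_class) : group_class :=
  fun G => forall V, is_variety V -> (forall H, X H -> V H) -> V G.

Definition locally_finite (V : group_class) : Prop :=
  forall G, V G -> finitely_generated G -> finite_group G.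

Definition finite_class (X : group_class) : Prop :=
  exists (n : nat) (Y : 'I_n -> groupType), forall G, X G -> exists i, G = Y i.

(** Alternative descriptions *)

Lemma generated_varietyP (X : group_class) (G : groupType) :
  generated_variety X G <->
  forall w, (forall H, X H -> satisfies_law H w) -> satisfies_law G w.
Proof.
split=> [XG w Xw | lawG V [W VW] XV].
  apply: (XG (fun K => satisfies_law K w)) => //.
  exists [set w] => K; split=> [Kw _ -> // | Kw]; exact: Kw.
by apply/VW => w Ww; apply: lawG => H /XV /VW; apply.
Qed.

Lemma generated_variety_is_variety (X : group_class) :
  is_variety (generated_variety X).
Proof.
exists [set w | forall H, X H -> satisfies_law H w] => G.
exact: generated_varietyP.
Qed.

Lemma is_subgroupP (G : groupType) (S : set G) :
  is_subgroup S <-> S 1 /\ forall x y, S x -> S y -> S (x * y^-1).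
Proof.
split=> [[/set_mem S1 SV] | [S1 SV]].
  by split=> // x y Sx Sy; apply/set_mem; apply: SV; apply/mem_set.
split; first exact/mem_set.
by move=> x y /set_mem Sx /set_mem Sy; apply/mem_set; apply: SV.
Qed.

(* D is a section of G iff it is a homomorphic image of a subgroup of G. *)
Lemma is_sectionP (D G : groupType) :
  is_section D G <->
  exists (S : set G) (f : G -> D),
    [/\ is_subgroup S, {in S &, {morph f : x y / x * y}} & f @` S = [set: D]].
Proof.
split.
- move=> [S [N [sS [sN NS nN] [phi [[phiS phiI phiO] phiM]]]]].
  have [S1 SV] := (is_subgroupP S).1 sS.
  have [N1 NV] := (is_subgroupP N).1 sN.
  have NM x y : N x -> N y -> N (x * y).
    move=> Nx Ny; rewrite -[y]invgK; apply: (NV) => //.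
    by rewrite -[y^-1]mul1g; apply: NV.
  have SM x y : S x -> S y -> S (x * y).
    move=> Sx Sy; rewrite -[y]invgK; apply: (SV) => //.
    by rewrite -[y^-1]mul1g; apply: SV.
  have cosM x y : S x -> S y -> set_mul (set_mul [set x] N) (set_mul [set y] N)
      = set_mul [set x * y] N.
    move=> Sx Sy; apply/seteqP; split=> z.
      move=> [_ [_ -> [n Nn <-]]] [_ [_ -> [m Nm <-]] <-].
      exists (x * y) => //; exists (n ^ y * m); first exact: NM (nN _ _ _ _) _.
      by rewrite conjgE !mulgA mulgK.
    move=> [_ -> [n Nn <-]]; exists (x * 1); first by exists x => //; exists 1.
    exists (y * n); first by exists y => //; exists n.
    by rewrite mulg1 mulgA.
  have phi_ex x : exists d : D, S x -> phi d = set_mul [set x] N.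
    have [Sx|nSx] := pselect (S x); last by exists 1.
    have [|d _ <-] := phiO (set_mul [set x] N); first by exists x.
    by exists d.
  have /choice [f fP] := phi_ex.
  exists S, f; split=> //.
    move=> x y /set_mem Sx /set_mem Sy; apply: phiI; rewrite ?inE //.
    by rewrite phiM !fP ?cosM //; apply: SM.
  apply/seteqP; split=> // d _; have [x Sx xd] := phiS d I.
  by exists x => //; apply: phiI; rewrite ?inE // fP.
- move=> [S [f [sS fM fO]]].
  have [S1 SV] := (is_subgroupP S).1 sS.
  have SVg y : S y -> S y^-1 by move=> Sy; rewrite -[y^-1]mul1g; apply: SV.
  have SM x y : S x -> S y -> S (x * y).
    by move=> Sx Sy; rewrite -[y]invgK; apply: (SV) => //; apply: SVg.
  have {}fM x y : S x -> S y -> f (x * y) = f x * f y.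
    by move=> Sx Sy; apply: fM; apply/mem_set.
  have f1 : f 1 = 1 by apply: (mulgI (f 1)); rewrite -fM // !mulg1.
  have fV x : S x -> f x^-1 = (f x)^-1.
    move=> Sx; apply: (mulgI (f x)); rewrite -fM ?mulgV ?f1 //.
    exact: SVg.
  pose N := [set x | S x /\ f x = 1].
  have cosE x : S x -> set_mul [set x] N = [set y | S y /\ f y = f x].
    move=> Sx; apply/seteqP; split=> y.
      move=> [_ -> [n [Sn fn] <-]].
      by split; [exact: SM | rewrite fM // fn mulg1].
    move=> [Sy fy]; exists x => //; exists (x^-1 * y); last by rewrite mulKVg.
    by split; [apply: SM => //; apply: SVg |
      rewrite fM ?fV ?fy ?mulVg //; exact: SVg].
  have fOx d : exists2 x, S x & f x = d.
    by have : [set: D] d by []; rewrite -fO => -[x Sx <-]; exists x.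
  exists S, N; split=> //.
    split; first (apply/is_subgroupP; split=> // x y [Sx fx] [Sy fy]).
    + split; first exact: SV.
      by rewrite fM ?fV ?fx ?fy ?mulgV //; apply: SVg.
    + by move=> x [].
    + move=> x n Sx [Sn fn]; have Sxi := SVg _ Sx.
      have Snx := SM _ _ Sn Sx; split; first by rewrite conjgE; apply: SM.
      by rewrite conjgE fM // fM // fV // fn mul1g mulVg.
  exists (fun d => [set y | S y /\ f y = d]); split.
    split.
    + move=> d _; have [x Sx fx] := fOx d.
      by exists x => //; rewrite cosE // fx.
    + move=> d e _ _ de; have [x Sx fx] := fOx d.
      have : [set y | S y /\ f y = d] x by [].
      by rewrite de /= => -[_ <-].
    + by move=> _ [x Sx <-]; exists (f x) => //; rewrite cosE.
  move=> d e; apply/seteqP; split=> z.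
    move=> [Sz fz]; have [x Sx fx] := fOx d.
    exists x => //; exists (x^-1 * z); last by rewrite mulKVg.
    split; first by apply: SM => //; apply: SVg.
    by rewrite fM ?fV ?fx ?fz ?mulKg //; apply: SVg.
  move=> [x [Sx fx]] [y [Sy fy] <-].
  by split; [exact: SM | rewrite fM // fx fy].
Qed.

(* Main.v *)
Require Import Defs.
From HB Require Import structures.
From mathcomp Require Import boolp classical_sets functions cardinality.
From mathcomp Require Import all_boot all_fingroup all_solvable.
From mathcomp Require Import generic_quotient.

Set Implicit Arguments.
Unset Strict Implicit.
Unset Printing Implicit Defensive.

Local Open Scope group_scope.
Local Open Scope quotient_scope.

(** Let F be the free group of the variety generated by X on finitely many
    generators, enough to map onto D.  In both parts of the theorem F is finite:
    in the first because F is a finitely generated member of a locally finite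
    variety ([relfree_in_variety], [relfree_finitely_generated]), in the second
    because an element of F is determined by the finitely many values it takes
    under substitutions into the groups of X ([finite_relfree]).  By
    construction homomorphisms from F to groups of X separate the elements of F
    ([relfree_separated]), and F maps onto D because D satisfies the laws of X.

    What remains is about a homomorphism f from a finite group F onto
    D = A B.  The subgroup A, being cyclic, lifts along f to a cyclic
    p-subgroup C of F, normalized by a p'-element t above a generator of B
    ([cyclic_lift]): a minimal t-invariant p-subgroup above A is cyclic, since
    modulo its Frattini subgroup Maschke's theorem complements any t-invariant
    subgroup.  Put T = C <t>, and let z have order p in C.  A normal subgroup K
    of T that avoids z meets the cyclic group C trivially; C is the Sylow
    p-subgroup of T, so K is a p'-group.  Its image in D is a normal p'-subgroup,
    and D has no nontrivial one, because it would contain B and centralize A.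
    So K lies in the kernel of f ([cyclic_detection]).  Now choose a
    homomorphism g from F to a group G of X with g z <> 1, and let K be the
    kernel of g on T: then f factors through g on T, and D is a quotient of the
    subgroup g(T) of G. *)

(** * Lifting a cyclic p-group with a coprime automorphism *)

(** Maschke's theorem for elementary abelian groups.  Since V splits over U and
    the index of V in V G is prime to p, Gaschutz's theorem yields a complement
    to U in V G; its intersection with V is the required G-invariant one. *)
Lemma abelem_Maschke (p : nat) (gT : finGroupType) (V U G : {group gT}) :
  p.-abelem V -> p^'.-group G -> U \subset V ->
  G \subset 'N(V) -> G \subset 'N(U) ->
  exists W : {group gT}, [/\ U * W = V, U :&: W = 1 & G \subset 'N(W)].
Proof.
move=> abelV p'G sUV nVG nUG.
have [pV abV _] := and3P abelV.
have pU := pgroupS sUV pV.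
have defVG : V <*> G = V * G := norm_joinEr nVG.
have nUV : V \subset 'N(U) by rewrite (subset_trans abV) ?cents_norm ?centS.
have nsU : U <| V <*> G.
  by rewrite /normal join_subG nUV nUG (subset_trans sUV) ?joing_subl.
have coVG : coprime #|U| #|V <*> G : V|.
  rewrite (pnat_coprime pU) // -divgS ?joing_subl //= defVG.
  rewrite TI_cardMg ?mulKn //; apply: coprime_TIg; exact: pnat_coprime pV p'G.
have : [splits V <*> G, over U].
  rewrite (Gaschutz_split nsU sUV) ?joing_subl ?(abelem_splits abelV) //.
  exact: abelianS sUV abV.
case/splitsP=> K /complP[tiUK defK].
have defV : U * (V :&: K) = V.
  by rewrite setIC group_modl //= defK (setIidPr (joing_subl V G)).
exists (V :&: K)%G; split=> //=; first by rewrite setICA tiUK setIg1.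
have nKK : K \subset 'N(V :&: K).
  have sK : K \subset V <*> G by rewrite -defK mulG_subr.
  rewrite normsI ?normG // (subset_trans sK) // join_subG normG //.
have sG : G \subset U * K by rewrite defK joing_subr.
apply: (subset_trans sG); rewrite mulG_subG nKK andbT.
rewrite (subset_trans sUV) // (subset_trans abV) // cents_norm //.
by rewrite centS ?subsetIl.
Qed.

(** The alternative drives the minimality argument of [cyclic_lift].  Writing
    A = f(P) and M for the preimage of Phi(A) in P, Maschke's theorem gives a
    t-invariant X with P = M X and M, X meeting in Phi(P).  Then A = Phi(A) f(X),
    hence f(X) = A; and X = P only if M = Phi(P). *)
Lemma Phi_lift (p : nat) (gT D : finGroupType) (S P : {group gT})
    (f : {morphism S >-> D}) (t : gT) :
    p.-group P -> P \subset S -> t \in S -> p^'.-elt t -> t \in 'N(P) ->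
  exists X : {group gT},
    [/\ X \subset P, t \in 'N(X), f @* X = f @* P &
        P :&: f @*^-1 'Phi(f @* P) \subset 'Phi(P) \/ X \proper P].
Proof.
move=> pP sPS St p't nPt.
set A := (f @* P)%G; set M := P :&: f @*^-1 'Phi(A).
have nAft : f t \in 'N('Phi(A)).
  rewrite -sub1set (char_norm_trans (Phi_char _)) //= -morphim_set1 //.
  by rewrite morphim_norms // sub1set.
have nMt : t \in 'N(M).
  rewrite -sub1set normsI ?sub1set //.
  have tpre : t \in f @*^-1 'N('Phi(A)) by apply/morphpreP.
  exact: subsetP (morphpre_norm _ _) _ tpre.
have sPhiM : 'Phi(P) \subset M.
  rewrite subsetI Phi_sub /= -sub_morphim_pre ?(morphim_Phi f pP sPS) //.
  exact: subset_trans (Phi_sub P) sPS.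
have nPhit : <[t]> \subset 'N('Phi(P)).
  by rewrite (char_norm_trans (Phi_char _)) // cycle_subG.
have [] := @abelem_Maschke p _ (P / 'Phi(P))%G (M / 'Phi(P))%G (<[t]> / 'Phi(P))%G.
- exact: Phi_quotient_abelem.
- exact: quotient_pgroup.
- exact: quotientS (subsetIl _ _).
- by rewrite quotient_norms // cycle_subG.
- by rewrite quotient_norms // cycle_subG.
move=> W /= [defV tiMW nWt].
pose X := (P :&: coset 'Phi(P) @*^-1 W)%G.
have nPhiP : P \subset 'N('Phi(P)) := gFnorm _ _.
have sPMX : P \subset M * X.
  apply/subsetP=> x Px; have Nx := subsetP nPhiP x Px.
  have : coset 'Phi(P) x \in M / 'Phi(P) * (W : {set _}).
    by rewrite defV mem_quotient.
  case/mulsgP=> u w /morphimP[m Nm Mm ->] Ww Exw.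
  apply/mulsgP; exists m (m^-1 * x); rewrite ?mulKVg //.
  have Pm : m \in P by case/setIP: Mm.
  have Nm' : m^-1 \in 'N('Phi(P)) by rewrite groupV.
  rewrite inE groupM ?groupV //=; apply/morphpreP; split; first exact: groupM.
  by rewrite morphM //= morphV //= Exw mulKg.
exists X; split.
- exact: subsetIl.
- rewrite -sub1set normsI ?sub1set //= -cycle_subG.
  exact: norm_quotient_pre.
- have sXP : X \subset P := subsetIl _ _.
  apply/eqP; rewrite eqEsubset morphimS //=.
  have sfX : f @* X \subset A by apply: morphimS.
  suff <- : <<f @* X>> = A by rewrite genGid.
  apply: Phi_nongen; apply/eqP; rewrite eqEsubset join_subG Phi_sub sfX /=.
  apply: subset_trans (mul_subG (joing_subl _ _) (joing_subr _ _)).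
  apply: subset_trans (morphimS f sPMX) _.
  have sMS : M \subset S by rewrite (subset_trans _ sPS) ?subsetIl.
  rewrite morphimMl // mulSg // sub_morphim_pre // subsetIr //.
- have [eXP | nXP] := eqVneq (X :&: P) P; last first.
    by right; rewrite properE subsetIl; apply: contra nXP => /setIidPr->.
  left; have sPW : P / 'Phi(P) \subset W.
    rewrite sub_morphim_pre //.
    by move/setIidPr: eXP; rewrite subsetI => /andP[].
  have trM : M / 'Phi(P) = 1.
    apply/trivgP; rewrite -tiMW subsetI subxx (subset_trans _ sPW) //.
    exact: quotientS (subsetIl _ _).
  rewrite -quotient_sub1 ?trM //.
  exact: subset_trans (subsetIl _ _) nPhiP.
Qed.

(** For P a Sylow p-subgroup of the preimage of A, the Frattini argument provides
    an element above b that normalizes P; its p'-part t is still above b.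
    Choose C minimal among the t-invariant subgroups of P that map onto A.  By
    [Phi_lift] an element of C whose image lies in Phi(A) is in Phi(C), so any c
    in C above a generator of A generates C modulo Phi(C), hence generates C. *)
Lemma cyclic_lift (p : nat) (gT D : finGroupType) (S : {group gT})
    (f : {morphism S >-> D}) (A : {group D}) (b : D) :
    cyclic A -> p.-group A -> A \subset f @* S ->
    b \in 'N(A) -> p^'.-elt b -> b \in f @* S ->
  exists (C : {group gT}) (t : gT),
    [/\ C \subset S, cyclic C, p.-group C & f @* C = A] /\
    [/\ t \in S, t \in 'N(C), p^'.-elt t & f t = b].
Proof.
move=> cycA pA sAfS nAb p'b /morphimP[t0 _ St0 Db].
pose H := (f @*^-1 A)%G; have sHS : H \subset S := subsetIl _ _.
have fH : f @* H = A by rewrite morphpreK.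
have [P sylP] := Sylow_exists p H.
have [sPH pP _] := and3P sylP; have sPS := subset_trans sPH sHS.
have fP : f @* P = A.
  by have := morphim_pHall f sPS sylP; rewrite fH => /pHall_id->.
have nHt0 : t0 \in 'N(H).
  have t0pre : t0 \in f @*^-1 'N(A) by apply/morphpreP; rewrite -Db.
  exact: subsetP (morphpre_norm _ _) _ t0pre.
have sylPt : p.-Sylow(H) (P :^ t0) by rewrite -(normP nHt0) pHallJ2.
have [h Hh defPt] := Sylow_trans sylP sylPt.
have Sh := subsetP sHS h Hh.
have : f h^-1 \in f @* P by rewrite fP -fH mem_morphim ?groupV.
case/morphimP=> k _ Pk Efh; have Sk := subsetP sPS k Pk.
(* t0 h^-1 normalizes P but its image is only in b A; the factor k^-1 in P
   corrects the image to b. *)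
pose t1 := t0 * h^-1 * k^-1.
have St1 : t1 \in S by rewrite !groupM ?groupV.
have nPt1 : t1 \in 'N(P).
  have nPk := subsetP (normG P) k Pk.
  rewrite groupMr ?groupV //; apply/normP.
  by rewrite conjsgM defPt -conjsgM mulgV conjsg1.
have ft1 : f t1 = b.
  by rewrite !morphM ?groupM ?groupV // Efh Db -[f k^-1]/(f k^-1) morphV // mulgK.
pose t := t1.`_p^'.
have t_cyc : t \in <[t1]> := cycle_constt _ _.
have St : t \in S by apply: subsetP t_cyc; rewrite cycle_subG.
have nPt : t \in 'N(P) by apply: subsetP t_cyc; rewrite cycle_subG.
have ft : f t = b by rewrite morph_constt // ft1 constt_p_elt.
have p't : p^'.-elt t := p_elt_constt _ _.
pose gP := [pred X : {group gT} |
  [&& X \subset P, t \in 'N(X) & f @* X == A]].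
have gPP : gP P by rewrite /= subxx nPt fP eqxx.
have [C /mingroupP[/and3P[sCP nCt /eqP fC] minC] _] := mingroup_exists gPP.
have pC := pgroupS sCP pP; have sCS := subset_trans sCP sPS.
exists C, t; split; split=> //.
have [X [sXC nXt fX [sMPhi | prX]]] := Phi_lift f pC sCS St p't nCt; last first.
  have := proper_sub prX; case/andP: prX => _ /negP[].
  rewrite minC //= fX fC eqxx nXt (subset_trans sXC) //.
rewrite fC in sMPhi; case/cyclicP: (cycA) => a defA.
have : a \in f @* C by rewrite fC defA cycle_id.
case/morphimP=> c _ Cc Ea; have Sc := subsetP sCS c Cc.
have -> // : C :=: <[c]>; last exact: cycle_cyclic.
apply/esym/Phi_nongen/eqP; rewrite eqEsubset join_subG Phi_sub sub1set Cc /=.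
apply/subsetP=> x Cx; have Sx := subsetP sCS x Cx.
have : f x \in <[a]> by rewrite -defA -fC mem_morphim.
case/cycleP=> n Efx.
have sC : c \in 'Phi(C) <*> [set c] by rewrite mem_gen // inE set11 orbT.
rewrite -[x](mulgKV (c ^+ n)) groupM ?groupX //.
apply: (subsetP (joing_subl _ _)); apply: (subsetP sMPhi).
rewrite inE groupM ?groupV ?groupX //=; apply/morphpreP.
have ScV : c ^- n \in S by rewrite groupV groupX.
split; first exact: groupM.
by rewrite morphM ?morphV ?groupX //= morphX // Efx Ea mulgV group1.
Qed.

(** * Homomorphisms onto D *)

Section OntoSemidirectProduct.

Variables (p q : nat) (D : finGroupType) (A B : {group D}).
Hypotheses (p_prime : prime p) (q_prime : prime q) (p_neq_q : p <> q).
Hypotheses (D_sdprod : A ><| B = [set: D]) (A_cyclic : cyclic A).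
Hypotheses (A_pgroup : p.-group A) (B_cyclic : cyclic B) (B_order : #|B| = q).
Hypothesis (AB_neq1 : [~: A, B] <> 1).

(** The order of K divides q.  If it were q, then K would be the unique Sylow
    q-subgroup of D, hence contain B; but K centralizes A, as both are normal
    and meet trivially. *)
Lemma normal_p'group_trivial (K : {group D}) :
  K <| [set: D] -> p^'.-group K -> K :=: 1.
Proof.
move=> nsK p'K; have [nsA _ defD nAB tiAB] := sdprod_context D_sdprod.
have oD : #|[set: D]| = (#|A| * q)%N by rewrite -B_order (sdprod_card D_sdprod).
have dvKq : #|K| %| q.
  rewrite -(@Gauss_dvdr _ #|A|) -?oD ?cardSg ?subsetT //.
  by rewrite coprime_sym (pnat_coprime A_pgroup).
have [K1 | ntK] := eqVneq #|K| 1%N; first exact: card1_trivg.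
have oK : #|K| = q by apply/prime_nt_dvdP.
have q'A : q^'.-group A.
  by apply: sub_in_pnat A_pgroup => r _ /eqnP->; apply/eqnP/eqP/eqP.
have sylK : q.-Sylow([set: D]) K.
  rewrite /pHall subsetT /pgroup oK pnat_id //= -divgS ?subsetT // oD oK.
  by rewrite mulnK ?prime_gt0.
have sBK : B \subset K.
  by rewrite (sub_normal_Hall sylK) ?subsetT // /pgroup B_order pnat_id.
have tiAK : A :&: K = 1.
  exact: coprime_TIg (pnat_coprime A_pgroup p'K).
case: AB_neq1; apply/trivgP; rewrite -tiAK.
apply: subset_trans (commgS A sBK) _.
rewrite commg_subI // subsetI subxx /=.
  exact: subset_trans (subsetT A) (normal_norm nsK).
exact: subset_trans (subsetT K) (normal_norm nsA).
Qed.

(** D survives in every quotient of T in which z does: z lies in the only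
    subgroup of order p of the Sylow p-subgroup of T, so a normal subgroup of T
    without z is a p'-group. *)
Lemma cyclic_detection (gT : finGroupType) (f : {morphism [set: gT] >-> D}) :
    f @* [set: gT] = [set: D] ->
  exists (T : {group gT}) (z : gT),
    [/\ f @* T = [set: D], z != 1 &
        forall K : {group gT}, K <| T -> z \notin K -> f @* K = 1].
Proof.
move=> f_onto; have [nsA _ defD nAB tiAB] := sdprod_context D_sdprod.
have [b defB] := cyclicP B_cyclic.
have Bb : b \in B by rewrite defB cycle_id.
have p'b : p^'.-elt b.
  rewrite /p_elt orderE -defB B_order; apply: sub_in_pnat (pnat_id q_prime).
  by move=> r _ /eqnP->; apply/eqnP => /esym.
have [] := @cyclic_lift p _ _ _ f A b A_cyclic A_pgroup.
- by rewrite f_onto subsetT.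
- exact: subsetP nAB b Bb.
- by [].
- by rewrite f_onto inE.
move=> C [t [[_ cycC pC fC] [_ nCt p't ft]]].
pose T := (C <*> <[t]>)%G.
have nCt' : <[t]> \subset 'N(C) by rewrite cycle_subG.
have defT : T :=: C * <[t]> := norm_joinEr nCt'.
have sCT : C \subset T := joing_subl _ _.
have nsCT : C <| T by rewrite /normal sCT join_subG normG.
have sylC : p.-Sylow(T) C.
  rewrite /pHall sCT pC /= -divgS //= defT TI_cardMg ?mulKn //.
  by apply: coprime_TIg; apply: pnat_coprime pC _.
have p_C : p %| #|C|.
  have : C :!=: 1.
    by apply/eqP => C1; case: AB_neq1; rewrite -fC C1 morphim1 comm1G.
  by case/(pgroup_pdiv pC).
have [z Cz oz] := Cauchy p_prime p_C.
have fT : f @* T = [set: D].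
  by rewrite /= defT morphimMl ?subsetT // fC morphim_cycle ?inE // ft -defB.
exists T, z; split=> //.
- by rewrite -order_gt1 oz prime_gt1.
move=> K nsKT Kz; apply: (normal_p'group_trivial (K := (f @* K)%G)).
  by rewrite /= -fT morphim_normal.
apply: morphim_pgroup; rewrite /pgroup p'natE //; apply: contra Kz => p_K.
have [y Ky oy] := Cauchy p_prime p_K.
have Cy : <[y]> \subset C.
  rewrite (sub_normal_Hall sylC) ?cycle_subG ?(subsetP (normal_sub nsKT)) //.
  by rewrite /pgroup [#|_|]oy pnat_id.
have szy : <[z]> \subset <[y]>.
  have sCz : <[z]> \subset C by rewrite cycle_subG.
  rewrite -(cardSg_cyclic cycC sCz Cy).
  by have -> : #|<[z]>| = #|<[y]>| by rewrite -[LHS]/#[z] -[RHS]/#[y] oz oy.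
by rewrite -cycle_subG (subset_trans szy) // cycle_subG.
Qed.

End OntoSemidirectProduct.

(** * Relatively free groups *)

Section Homomorphisms.

Variables (G H : groupType) (f : G -> H).
Hypothesis fM : {morph f : x y / x * y}.

Lemma mulg_morph1 : f 1 = 1.
Proof. by apply: (mulgI (f 1)); rewrite -fM !mulg1. Qed.

Lemma mulg_morphV x : f x^-1 = (f x)^-1.
Proof. by apply: (mulgI (f x)); rewrite -fM !mulgV mulg_morph1. Qed.

Lemma morph_eval_word (v : nat -> G) w :
  f (eval_word v w) = eval_word (f \o v) w.
Proof.
rewrite /eval_word (big_morph f fM mulg_morph1); apply: eq_bigr => -[n []] _ //=.
exact: mulg_morphV.
Qed.

End Homomorphisms.

Section Words.

Variable G : groupType.
Implicit Types (v : nat -> G) (w : word).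

Definition inverse_word w : word := rev [seq (l.1, ~~ l.2) | l <- w].

Lemma eval_word_cat v w1 w2 :
  eval_word v (w1 ++ w2) = eval_word v w1 * eval_word v w2.
Proof. exact: big_cat. Qed.

Lemma eval_inverse_word v w :
  eval_word v (inverse_word w) = (eval_word v w)^-1.
Proof.
elim: w => [|[n b] w IHw]; first by rewrite /eval_word !big_nil invg1.
rewrite /inverse_word /= rev_cons -cats1 eval_word_cat IHw.
rewrite -(cat1s _ w) eval_word_cat invMg; congr (_ * _).
by rewrite /eval_word !big_seq1 /=; case: b; rewrite /= ?invgK.
Qed.

End Words.

(** Two words are identified when they agree under all substitutions into groups
    of X.  The letters are read through [inord], so that x_n with n > k is
    another name of x_0 and only k + 1 letters count. *)
Definition relfree_eq (X : group_class) (k : nat) : rel word := fun w1 w2 =>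
  `[< forall H, X H -> forall v : 'I_k.+1 -> H,
        eval_word (v \o inord) w1 = eval_word (v \o inord) w2 >].

Lemma relfree_eq_refl X k : reflexive (relfree_eq X k).
Proof. by move=> w; apply/asboolP. Qed.

Lemma relfree_eq_sym X k : symmetric (relfree_eq X k).
Proof. by move=> w1 w2; apply/asboolP/asboolP => E H XH v; rewrite E. Qed.

Lemma relfree_eq_trans X k : transitive (relfree_eq X k).
Proof.
move=> w2 w1 w3 /asboolP E12 /asboolP E23; apply/asboolP => H XH v.
by rewrite E12 ?E23.
Qed.

Canonical relfree_equiv X k := EquivRel (relfree_eq X k)
  (@relfree_eq_refl X k) (@relfree_eq_sym X k) (@relfree_eq_trans X k).

(** The free group of rank k + 1 of the variety generated by X. *)
Definition relfree X k := {eq_quot (relfree_equiv X k)}.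
HB.instance Definition _ X k := Choice.on (relfree X k).
HB.instance Definition _ X k := Quotient.on (relfree X k).

Section RelativelyFree.

Variables (X : group_class) (k : nat).
Local Notation F := (relfree X k).

Definition relfree_eval (G : groupType) (u : 'I_k.+1 -> G) (x : F) : G :=
  eval_word (u \o inord) (repr x).

(** Evaluation does not depend on the word representing an element, even outside
    X: if w1 and w2 are identified, then the word w1 w2^-1 with its letters
    renamed into x_0, ..., x_k is a law of X. *)
Lemma eval_pi (G : groupType) (u : 'I_k.+1 -> G) (w : word) :
  generated_variety X G ->
  relfree_eval u (\pi_F w) = eval_word (u \o inord) w.
Proof.
move=> /generated_varietyP XG.
have /eqmodP/asboolP E : repr (\pi_F w) = w %[mod F] by rewrite reprK.
set w0 := repr _ in E.
pose ren (w' : word) : word := [seq (val (@inord k l.1), l.2) | l <- w'].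
have evren (H : groupType) (v : nat -> H) w' :
    eval_word v (ren w') = eval_word (v \o val \o @inord k) w'.
  by rewrite /eval_word big_map.
have := XG (ren (w0 ++ inverse_word w)).
move=> /(_ _ (u \o inord)); rewrite /satisfies_law evren.
rewrite eval_word_cat eval_inverse_word.
have -> : (u \o inord) \o val \o @inord k = u \o inord.
  by apply/funext => n /=; rewrite inord_val.
move=> law; apply: (mulIg (eval_word (u \o inord) w)^-1).
rewrite mulgV; apply: law => H XH v.
by rewrite evren eval_word_cat eval_inverse_word E // mulgV.
Qed.

Lemma generating_in_variety (H : groupType) : X H -> generated_variety X H.
Proof. by move=> XH V _; apply. Qed.

Lemma relfree_separated (x y : F) :
  (forall H, X H -> forall v : 'I_k.+1 -> H,
     relfree_eval v x = relfree_eval v y) -> x = y.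
Proof.
by move=> E; rewrite -[x]reprK -[y]reprK; apply/eqmodP/asboolP.
Qed.

Definition relfree_one : F := \pi_F [::].
Definition relfree_mul (x y : F) : F := \pi_F (repr x ++ repr y).
Definition relfree_inv (x : F) : F := \pi_F (inverse_word (repr x)).

Lemma eval_one (G : groupType) (u : 'I_k.+1 -> G) :
  generated_variety X G -> relfree_eval u relfree_one = 1.
Proof. by move=> XG; rewrite eval_pi // /eval_word big_nil. Qed.

Lemma eval_mul (G : groupType) (u : 'I_k.+1 -> G) x y :
  generated_variety X G ->
  relfree_eval u (relfree_mul x y) = relfree_eval u x * relfree_eval u y.
Proof. by move=> XG; rewrite eval_pi // eval_word_cat. Qed.

Lemma eval_inv (G : groupType) (u : 'I_k.+1 -> G) x :
  generated_variety X G ->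
  relfree_eval u (relfree_inv x) = (relfree_eval u x)^-1.
Proof. by move=> XG; rewrite eval_pi // eval_inverse_word. Qed.

Fact relfree_mulA : associative relfree_mul.
Proof.
move=> x y z; apply: relfree_separated => H /generating_in_variety XH v.
by rewrite !eval_mul ?mulgA.
Qed.

Fact relfree_mul1 : left_id relfree_one relfree_mul.
Proof.
move=> x; apply: relfree_separated => H /generating_in_variety XH v.
by rewrite eval_mul ?eval_one ?mul1g.
Qed.

Fact relfree_1mul : right_id relfree_one relfree_mul.
Proof.
move=> x; apply: relfree_separated => H /generating_in_variety XH v.
by rewrite eval_mul ?eval_one ?mulg1.
Qed.

Fact relfree_mulV : left_inverse relfree_one relfree_inv relfree_mul.
Proof.
move=> x; apply: relfree_separated => H /generating_in_variety XH v.
by rewrite eval_mul ?eval_inv ?eval_one ?mulVg.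
Qed.

Fact relfree_Vmul : right_inverse relfree_one relfree_inv relfree_mul.
Proof.
move=> x; apply: relfree_separated => H /generating_in_variety XH v.
by rewrite eval_mul ?eval_inv ?eval_one ?mulgV.
Qed.

HB.instance Definition _ := isGroup.Build (relfree X k)
  relfree_mulA relfree_mul1 relfree_1mul relfree_mulV relfree_Vmul.

Lemma relfree_evalM (G : groupType) (u : 'I_k.+1 -> G) :
  generated_variety X G -> {morph relfree_eval u : x y / x * y}.
Proof. by move=> XG x y; apply: eval_mul. Qed.

Lemma relfree_eval_gen (G : groupType) (u : 'I_k.+1 -> G) n :
  generated_variety X G -> relfree_eval u (\pi_F [:: (n, false)]) = u (inord n).
Proof. by move=> XG; rewrite eval_pi // /eval_word big_seq1. Qed.

Lemma relfree_in_variety : generated_variety X (relfree X k).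
Proof.
apply/generated_varietyP => w Xw v; apply: relfree_separated => H XH u.
have XH' := generating_in_variety XH.
by rewrite (morph_eval_word (relfree_evalM _ XH')) eval_one // Xw.
Qed.

Lemma relfree_finitely_generated : finitely_generated (relfree X k).
Proof.
pose g (i : 'I_k.+1) := \pi_F [:: (val i, false)].
exists (range g); split; first exact/finite_image/finite_finset.
apply/seteqP; split=> // x _ M [/is_subgroupP[M1 MV] gM].
have MVg y : M y -> M y^-1 by move=> My; rewrite -[y^-1]mul1g; apply: MV.
have MM y z : M y -> M z -> M (y * z).
  by move=> My Mz; rewrite -[z]invgK; apply: MV => //; apply: MVg.
have Mg i : M (g i) by apply: gM; exists i.
have -> : x = eval_word (g \o inord) (repr x).
  apply: relfree_separated => H XH u; have XH' := generating_in_variety XH.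
  rewrite (morph_eval_word (relfree_evalM _ XH')) /relfree_eval.
  congr eval_word; apply/funext => n /=.
  rewrite [LHS](_ : _ = relfree_eval u (g (inord n))) //.
  by rewrite relfree_eval_gen // inord_val.
rewrite /eval_word; elim/big_ind: _ => // -[n []] _ //=.
exact: MVg.
Qed.

End RelativelyFree.

(** * Finiteness *)

(** An equality, not only an isomorphism, so that FG can replace G in any
    statement. *)
Lemma finite_groupP (G : groupType) :
  finite_group G -> exists FG : finGroupType, FG = G :> groupType.
Proof.
case: G => T c; set G := Group.Pack c.
move=> /finite_seqP[s0 sT]; pose s := undup s0.
have s_mem x : x \in s by rewrite mem_undup; have : [set: G]%classic x by []; rewrite sT.
have sP : Finite.axiom s.
  by apply: Finite.uniq_enumP; [exact: undup_uniq | move=> x; rewrite s_mem].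
have sK : pcancel (index^~ s) (fun n => nth None (map Some s) n).
  by move=> x; rewrite (nth_map x) ?index_mem ?nth_index.
pose FG : finGroupType :=
  HB.pack_for finGroupType (Group.sort G) G
    (isCountable.Build (Group.sort G) sK) (isFinite.Build (Group.sort G) sP).
by exists FG.
Qed.

(** For each Y i in X the map sending a word to the function it induces on
    (k + 1)-tuples of Y i has finite range; its values are encoded as natural
    numbers, so that the codes for all i form one finite type. *)
Lemma finite_relfree (X : group_class) k :
  finite_class X -> (forall G, X G -> finite_group G) ->
  finite_group (relfree X k).
Proof.
move=> [n [Y XY]] Xfin.
have count_class (i : 'I_n) : exists c : word -> nat,
    (exists N, forall w, (c w < N)%N) /\
    forall w1 w2, c w1 = c w2 -> X (Y i) -> forall u : 'I_k.+1 -> Y i,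
      eval_word (u \o inord) w1 = eval_word (u \o inord) w2.
  (* A Y i outside X imposes no condition: its code is constant. *)
  have [XYi | nXYi] := pselect (X (Y i)); last first.
    by exists (fun=> 0%N); split=> //; exists 1%N.
  have [FG <-] := finite_groupP (Xfin _ XYi).
  pose phi w : {ffun {ffun 'I_k.+1 -> FG} -> FG} :=
    [ffun u : {ffun 'I_k.+1 -> FG} => eval_word (u \o inord) w].
  exists (fun w => val (enum_rank (phi w))); split.
    by eexists => w; apply: ltn_ord.
  move=> w1 w2 /val_inj/enum_rank_inj Ephi _ u.
  have := congr1 (fun h : {ffun _ -> _} => h [ffun j => u j]) Ephi.
  rewrite !ffunE; congr (eval_word _ _ = eval_word _ _);
    by apply/funext => j /=; rewrite ffunE.
have [c cP] := choice count_class.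
have [N cN] := choice (fun i => (cP i).1).
pose M := (\max_i N i)%N.
have cM i w : (c i w <= M)%N.
  exact: leq_trans (ltnW (cN i w)) (leq_bigmax i).
pose code (x : relfree X k) : {ffun 'I_n -> 'I_M.+1} :=
  [ffun i => inord (c i (repr x))].
have code_inj : injective code.
  move=> x y Exy; apply: relfree_separated => H XH u.
  have [i Hi] := XY H XH; subst H.
  apply: ((cP i).2 _ _ _ XH u).
  have := congr1 (fun h : {ffun _ -> _} => val (h i)) Exy.
  by rewrite !ffunE /= !inordK ?ltnS ?cM.
have := @finite_preimage _ _ [set: {ffun 'I_n -> 'I_M.+1}]%classic code.
by rewrite preimage_setT; apply; [move=> x y _ _; apply: code_inj | exact: finite_finset].
Qed.

(** * Sections from homomorphisms *)

Lemma factor_section (gT D : finGroupType) (G : groupType) (T : {group gT})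
    (f : {morphism [set: gT] >-> D}) (g : gT -> G) :
  {morph g : x y / x * y} -> f @* T = [set: D] ->
  (forall x, x \in T -> g x = 1 -> f x = 1) -> is_section D G.
Proof.
move=> gM fT kergf.
have g1 := mulg_morph1 gM; have gV := mulg_morphV gM.
have fg x y : x \in T -> y \in T -> g x = g y -> f x = f y.
  move=> Tx Ty gxy; apply: (mulIg (f y)^-1).
  rewrite mulgV -morphV ?inE // -morphM ?inE //.
  by apply: kergf; rewrite ?groupM ?groupV // gM gV gxy mulgV.
have h_ex (z : G) : exists d : D, forall x, x \in T -> g x = z -> d = f x.
  have [[x [Tx <-]] | noz] := pselect (exists x, x \in T /\ g x = z).
    by exists (f x) => y Ty gy; apply: fg.
  by exists 1 => x Tx gx; case: noz; exists x.
have [h hP] := choice h_ex.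
apply/is_sectionP; exists [set z | exists2 x, x \in T & g x = z]%classic, h.
split.
- apply/is_subgroupP; split; first by exists 1.
  move=> _ _ [x Tx <-] [y Ty <-]; exists (x * y^-1); first by rewrite groupM ?groupV.
  by rewrite gM gV.
- move=> _ _ /set_mem[x Tx <-] /set_mem[y Ty <-].
  rewrite -gM !(hP _ _ _ erefl) ?groupM //.
  by rewrite morphM ?inE.
- apply/seteqP; split=> // d _.
  have : d \in f @* T by rewrite fT inE.
  case/morphimP=> x _ Tx ->; exists (g x); first by exists x.
  exact: hP.
Qed.

Section Main.

Variables (p q : nat) (p_prime : prime p) (q_prime : prime q)
    (p_neq_q : p <> q) (D : finGroupType) (A B : {group D})
    (D_sdprod : (A ><| B)%g = [set: D])
    (A_cyclic : cyclic A) (A_pgroup : (p.-group A)%g)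
    (B_cyclic : cyclic B) (B_order : #|B| = q)
    (AB_neq1 : [~: A, B]%g <> 1%g) (X : group_class).

(** [cyclic_detection] reduces the separation of all elements of F to that of a
    single one, so that one group of X suffices. *)
Lemma section_of_separated (F : groupType) (f : F -> D) :
    finite_group F -> {morph f : x y / x * y} -> (forall d, exists x, f x = d) ->
    (forall z : F, z <> 1 ->
       exists2 G : groupType, X G &
         exists2 g : F -> G, {morph g : x y / x * y} & g z <> 1) ->
  exists2 G : groupType, X G & is_section D G.
Proof.
move=> finF; have [FT E] := finite_groupP finF; subst F.
move=> fM f_onto sepF.
pose fm := @Morphism _ _ [set: FT] f (in2W fM).
have fm_onto : fm @* [set: FT] = [set: D].
  apply/setP=> d; rewrite inE; have [x <-] := f_onto d.
  by apply: (mem_morphim fm); rewrite inE.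
have [T [z [fT z_neq1 detect]]] := cyclic_detection p_prime q_prime p_neq_q
  D_sdprod A_cyclic A_pgroup B_cyclic B_order AB_neq1 fm_onto.
have [G XG [g gM gz]] := sepF z (elimN eqP z_neq1).
exists G => //.
have g1 := mulg_morph1 gM; have gV := mulg_morphV gM.
have K_group : group_set [set x in T | g x == 1]%SET.
  apply/group_setP; split=> [|x y]; rewrite !inE ?g1 ?group1 ?eqxx //.
  move=> /andP[Tx /eqP gx] /andP[Ty /eqP gy].
  by rewrite groupM // gM gx gy mulg1 eqxx.
pose K := Group K_group.
have nsKT : K <| T.
  apply/normalP; split; first by apply/subsetP=> x; rewrite inE => /andP[].
  move=> y Ty; apply/setP=> x; rewrite mem_conjg !inE groupJr ?groupV //.
  congr (_ && _); rewrite conjgE !gM invgK gV.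
  rewrite mulgA -(inj_eq (mulIg (g y))) mulgKV mul1g.
  by rewrite -{2}[g y]mulg1 (inj_eq (mulgI _)).
have Kz : z \notin K by rewrite inE negb_and orbC; apply/orP; left; apply/eqP.
have fK := detect K nsKT Kz.
apply: (@factor_section _ _ _ T fm g) => // x Tx gx.
apply/set1gP; rewrite -[[1]]fK; apply: mem_morphim; rewrite inE // Tx.
exact/eqP.
Qed.

Lemma section_of_finite_relfree : finite_group (relfree X #|D|) ->
  generated_variety X D -> exists2 G : groupType, X G & is_section D G.
Proof.
move=> finF XD; pose u (i : 'I_#|D|.+1) : D := nth 1 (enum D) i.
apply: (@section_of_separated _ (@relfree_eval X _ _ u)) => //.
- exact: relfree_evalM.
- move=> d; exists (\pi_(relfree X #|D|) [:: (index d (enum D), false)])%qT.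
  rewrite relfree_eval_gen // /u inordK ?nth_index ?mem_enum //.
  by rewrite ltnS cardE index_size.
- move=> z z_neq1; apply: contrapT => no_sep; apply: z_neq1.
  apply: relfree_separated => H XH v; apply: contrapT => vz; apply: no_sep.
  have XH' := generating_in_variety XH.
  exists H => //; exists (relfree_eval v); first exact: relfree_evalM.
  by move=> v1; apply: vz; rewrite v1 eval_one.
Qed.

End Main.

Theorem mainTheorem2 (p q : nat) (p_prime : prime p) (q_prime : prime q)
    (p_neq_q : p <> q) (D : finGroupType) (A B : {group D})
    (D_sdprod : (A ><| B)%g = [set: D])
    (A_cyclic : cyclic A) (A_pgroup : (p.-group A)%g)
    (B_cyclic : cyclic B) (B_order : #|B| = q)
    (AB_neq1 : [~: A, B]%g <> 1%g) (X : group_class) :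
  (forall L : group_class,
     (forall G : groupType, L G <-> generated_variety X G) ->
     locally_finite L -> L D ->
     exists2 G : groupType, X G & is_section D G)
  /\
  (finite_class X -> (forall G : groupType, X G -> finite_group G) ->
   generated_variety X D ->
   exists2 G : groupType, X G & is_section D G).
Proof.
have sectionP := section_of_finite_relfree p_prime q_prime p_neq_q D_sdprod
  A_cyclic A_pgroup B_cyclic B_order AB_neq1 (X := X).
split=> [L LX Lfin /LX XD | Xfin Xgfin XD]; apply: sectionP => //.
  apply: Lfin (relfree_finitely_generated X _).
  by apply/LX; apply: relfree_in_variety.
exact: finite_relfree.
Qed.
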